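(* Consider an active STAR element with coupled transmission and reflection (T&R) phase-shift, i.e. a four-port quadrature hybrid with complex input voltages $V_1^+,\dots,V_4^+$ and output voltages $V_1^-,\dots,V_4^-$ satisfying $$\begin{pmatrix} V_1^- \\ V_2^- \\ V_3^- \\ V_4^- \end{pmatrix}=-\frac{1}{\sqrt2}\begin{pmatrix}0&j&1&0\\ j&0&0&1\\ 1&0&0&j\\ 0&1&j&0\end{pmatrix}\begin{pmatrix} V_1^+ \\ V_2^+ \\ V_3^+ \\ V_4^+ \end{pmatrix},$$ whose port 2 is connected to a delay line and reflection-type amplifier with combined complex gain $\tilde G\in\mathbb{C}$, so that $V_2^+=\tilde G V_2^-$, and whose port 3 is grounded, so that $V_3^+=0$. Then the four T&R coefficients of the element are $$R^A_m=\frac{V_1^-}{V_1^+}\Big|_{V_4^+=0}=-\frac{\tilde G}{2},\qquad R^B_m=\frac{V_4^-}{V_4^+}\Big|_{V_1^+=0}=\frac{\tilde G}{2},$$ $$T^{AB}_m=\frac{V_1^-}{V_4^+}\Big|_{V_1^+=0}=\frac{j\tilde G}{2},\qquad T^{BA}_m=\frac{V_4^-}{V_1^+}\Big|_{V_4^+=0}=\frac{j\tilde G}{2}.$$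
   Context: Here $j$ is the imaginary unit, and $m$ indexes the element. Port 1 of the hybrid is side A of the element and port 4 is side B: $V_1^+,V_4^+$ are the signals incident from sides A and B (arbitrary complex numbers), and $V_1^-,V_4^-$ are the signals leaving through sides A and B. The combined gain is $\tilde G=G_2e^{j\phi_2}$, where $G_2$ is the amplifier gain and $\phi_2$ the phase delay. $R^A_m,R^B_m$ are the reflection coefficients on sides A and B; $T^{AB}_m$ is the transmission coefficient from a signal incident on side B to the output on side A, and $T^{BA}_m$ that from a signal incident on side A to the output on side B. The notation $\frac{V_i^-}{V_k^+}\big|_{V_l^+=0}$ means the ratio of these voltages when $V_l^+=0$ and $V_k^+\neq 0$. *)

(* Defs.v *)
From mathcomp Require Import all_boot all_order all_algebra.
From mathcomp Require Import reals.
From mathcomp Require Import complex.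

Set Implicit Arguments.
Unset Strict Implicit.
Unset Printing Implicit Defensive.

Local Open Scope ring_scope.
Local Open Scope complex_scope.

Definition port1 : 'I_4 := @Ordinal 4 0 isT.
Definition port2 : 'I_4 := @Ordinal 4 1 isT.
Definition port3 : 'I_4 := @Ordinal 4 2 isT.
Definition port4 : 'I_4 := @Ordinal 4 3 isT.

(* Scattering matrix of the quadrature hybrid; the table lists its rows. *)
Definition hybrid_scattering (R : realType) : 'M[R[i]]_4 :=
  - ((Num.sqrt 2)%:C)^-1 *:
    \matrix_(r, c) nth 0 (nth [::] [:: [:: 0;    'i%C; 1;    0];
                                       [:: 'i%C; 0;    0;    1];
                                       [:: 1;    0;    0;    'i%C];
                                       [:: 0;    1;    'i%C; 0]] r) c.

(* Vp lists the incoming voltages V_1^+, ..., V_4^+ and Vm the outgoing ones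
   V_1^-, ..., V_4^-. Port 2 carries the delay line and the reflection-type
   amplifier, of combined gain G; port 3 is grounded. Ports 1 and 4 are the
   sides A and B, and their incoming voltages are free. *)
Definition star_state (R : realType) (G : R[i]) (Vp Vm : 'cV[R[i]]_4) : Prop :=
  [/\ Vm = hybrid_scattering R *m Vp,
      Vp port2 0 = G * Vm port2 0
    & Vp port3 0 = 0].

(* (V_i^- / V_k^+)|_{V_l^+ = 0} = c. The first clause says that every nonzero
   incident voltage at port k is realized with port l silent, so the second
   clause is never vacuous and c is unique. *)
Definition port_ratio (R : realType) (G : R[i]) (i k l : 'I_4) (c : R[i]) :
    Prop :=
  (forall v : R[i], v != 0 ->
     exists Vp Vm, [/\ star_state G Vp Vm, Vp k 0 = v & Vp l 0 = 0]) /\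
  (forall Vp Vm : 'cV[R[i]]_4, star_state G Vp Vm ->
     Vp l 0 = 0 -> Vp k 0 != 0 -> Vm i 0 / Vp k 0 = c).

Definition reflection_A (R : realType) (G c : R[i]) : Prop :=
  port_ratio G port1 port1 port4 c.

Definition reflection_B (R : realType) (G c : R[i]) : Prop :=
  port_ratio G port4 port4 port1 c.

(* T^{AB}: incident on side B, output on side A. *)
Definition transmission_AB (R : realType) (G c : R[i]) : Prop :=
  port_ratio G port1 port4 port1 c.

(* T^{BA}: incident on side A, output on side B. *)
Definition transmission_BA (R : realType) (G c : R[i]) : Prop :=
  port_ratio G port4 port1 port4 c.

(* Main.v *)
Require Import Defs.
From mathcomp Require Import all_boot all_order all_algebra.
From mathcomp Require Import reals.
From mathcomp Require Import complex.
From mathcomp Require Import ring.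

Import GRing.Theory Num.Theory.

Local Open Scope ring_scope.
Local Open Scope complex_scope.

(* Eliminating the port-2 feedback loop V_2^+ = G V_2^- contributes the factor
   (- 1 / sqrt 2)^2 = 1 / 2: one passage through the hybrid before the amplifier
   and one after it. The two-port seen from the sides A and B is then
   V_1^- = (G / 2) (- V_1^+ + j V_4^+) and V_4^- = (G / 2) (j V_1^+ + V_4^+). *)

Definition hybrid_gain (R : realType) : R[i] := - ((Num.sqrt 2)%:C)^-1.

Lemma hybrid_gain_sqr (R : realType) : hybrid_gain R * hybrid_gain R = 2^-1.
Proof.
rewrite /hybrid_gain mulrNN -invfM -rmorphM /= -expr2 sqr_sqrtr ?ler0n //.
by rewrite rmorph_nat.
Qed.

Lemma hybrid_output (R : realType) (V : 'cV[R[i]]_4) :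
  let W := hybrid_scattering R *m V in
  [/\ W port1 0 = hybrid_gain R * ('i%C * V port2 0 + V port3 0),
      W port2 0 = hybrid_gain R * ('i%C * V port1 0 + V port4 0)
    & W port4 0 = hybrid_gain R * (V port2 0 + 'i%C * V port3 0)].
Proof.
have ports (F : 'I_4 -> R[i]) :
    \sum_r F r = F port1 + F port2 + F port3 + F port4.
  rewrite !big_ord_recr big_ord0 /= add0r.
  by congr (F _ + F _ + F _ + F _); exact: val_inj.
rewrite /= /hybrid_scattering -/(hybrid_gain R) -scalemxAl.
by split; rewrite mxE [in LHS]mxE ports !mxE /=; ring.
Qed.

(** The hybrid has no self-reflection at port 2: [V_2^-] does not depend on [V_2^+]. The amplifier
    loop is thus solved explicitly for every [G], with no resonance to exclude. *)
Lemma star_state_exists (R : realType) (G a b : R[i]) :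
  exists Vp Vm, [/\ star_state G Vp Vm, Vp port1 0 = a & Vp port4 0 = b].
Proof.
pose Vp : 'cV[R[i]]_4 := \col_r
  nth 0 [:: a; G * (hybrid_gain R * ('i%C * a + b)); 0; b] r.
exists Vp, (hybrid_scattering R *m Vp).
split; [split=> // | by rewrite mxE.. ]; last by rewrite mxE.
by have [_ -> _] := hybrid_output R Vp; rewrite !mxE.
Qed.

Lemma star_state_output (R : realType) (G : R[i]) (Vp Vm : 'cV[R[i]]_4) :
  star_state G Vp Vm ->
  Vm port1 0 = G / 2 * (- Vp port1 0 + 'i%C * Vp port4 0) /\
  Vm port4 0 = G / 2 * ('i%C * Vp port1 0 + Vp port4 0).
Proof.
case=> -> V2 V3; have [-> W2 ->] := hybrid_output R Vp.
rewrite V3 V2 W2 -hybrid_gain_sqr; split; last by ring.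
have i2 : 'i%C * 'i%C = -1 :> R[i] by rewrite -expr2 sqr_i.
(* [ring] treats ['i] as an atom, so the sign is first rewritten as ['i * 'i], the two quadrature
   crossings from port 1 to port 2 and back. *)
by rewrite -[- Vp port1 0]mulN1r -i2; ring.
Qed.

Theorem theorem1 (R : realType) (G : R[i]) :
  [/\ reflection_A G (- (G / 2)),
      reflection_B G (G / 2),
      transmission_AB G ('i%C * G / 2)
    & transmission_BA G ('i%C * G / 2)].
Proof.
split; split.
(* The odd goals are the realizability clauses, the even ones the ratios. *)
1,3,5,7: move=> v _.
- exact: star_state_exists.
- by have [Vp [Vm [st V1 V4]]] := star_state_exists R G 0 v; exists Vp, Vm.
- by have [Vp [Vm [st V1 V4]]] := star_state_exists R G 0 v; exists Vp, Vm.
- exact: star_state_exists.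
all: move=> Vp Vm /star_state_output[V1 V4] Vl0 Vk0.
(* Clearing the nonzero denominator leaves an identity linear in [V_k^+]. *)
all: apply: (canLR (mulfK Vk0)); rewrite ?V1 ?V4 Vl0; ring.
Qed.
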